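(* Let $(X,\mathcal{E})$ be a coarse space. Suppose that $X=X_1\cup X_2$, where each $X_i$ ($i=1,2$) is given the coarse structure it inherits from $X$. If $X_1$ and $X_2$ have coarse property C, then so does $X$.
   Context: A coarse structure on a set $X$ is a collection $\mathcal{E}$ of subsets of $X\times X$, called entourages, such that: subsets of entourages are entourages; finite unions of entourages are entourages; the diagonal $\Delta_X$ is an entourage; inverses $E^{-1}=\{(y,x)\mid (x,y)\in E\}$ of entourages are entourages; compositions $E_1\circ E_2=\{(x,z)\mid \exists y\in X,\ (x,y)\in E_1,\ (y,z)\in E_2\}$ of entourages are entourages. The pair $(X,\mathcal{E})$ is a coarse space. A subset $A\subseteq X$ inherits the coarse structure $\{E\cap(A\times A)\mid E\in\mathcal{E}\}$. For $E\in\mathcal{E}$, a family $\mathcal{U}$ of subsets of $X$ is $E$-disjoint if $(A\times B)\cap E=\emptyset$ whenever $A,B\in\mathcal{U}$, $A\ne B$. The family $\mathcal{U}$ is uniformly bounded if $\bigcup_{U\in\mathcal{U}}(U\times U)\in\mathcal{E}$. Coarse property C: for any sequence $L_1\subseteq L_2\subseteq L_3\subseteq\cdots$ of entourages there are an $n$ and a finite sequence $\mathcal{U}^1,\ldots,\mathcal{U}^n$ of families of subsets of $X$ such that $\bigcup_{i=1}^n\mathcal{U}^i$ covers $X$, each $\mathcal{U}^i$ is uniformly bounded, and each $\mathcal{U}^i$ is $L_i$-disjoint. *)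

(* Defs.v *)
From mathcomp Require Import all_boot.
From mathcomp Require Import boolp classical_sets.

Set Implicit Arguments.
Unset Strict Implicit.
Unset Printing Implicit Defensive.

Local Open Scope classical_set_scope.

(* Closure under finite unions is given by its binary case; the empty union is
   an entourage as a subset of the diagonal (see [entourage0]). *)
Record coarse_structure (X : Type) := CoarseStructure {
  entourages : set (set (X * X));
  entourage_subset : forall E F : set (X * X),
    F `<=` E -> entourages E -> entourages F;
  entourageU : forall E F : set (X * X),
    entourages E -> entourages F -> entourages (E `|` F);
  entourage_diag : entourages diagonal;
  entourage_inv : forall E : set (X * X),
    entourages E -> entourages (E^-1)%relation;
  entourage_comp : forall E F : set (X * X),
    entourages E -> entourages F -> entourages (E \; F)%relation
}.

Lemma entourage0 (X : Type) (E : coarse_structure X) : entourages E set0.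
Proof. exact: entourage_subset (@sub0set _ _) (entourage_diag E). Qed.

Section Subspace.
Context {X : Type} (E : coarse_structure X) (A : set X).

Definition sub_pair (p : A * A) : X * X := (val p.1, val p.2).

Lemma sub_pair_inj : injective sub_pair.
Proof. by move=> [x y] [x' y'] [] /val_inj -> /val_inj ->. Qed.

(* The preimage of L is L `&` (A `*` A) seen as a set of pairs of points of the
   subtype A; see [image_sub_pair]. *)
Definition sub_entourages : set (set (A * A)) :=
  [set sub_pair @^-1` L | L in entourages E].

Lemma image_sub_pair (L : set (X * X)) :
  sub_pair @` (sub_pair @^-1` L) = L `&` (A `*` A).
Proof.
apply/seteqP; split=> [_ [[x y] /= Lxy <-]|[x y] [Lxy [/= Ax Ay]]].
  by split=> //; split; exact: set_valP.
by exists (SigSub (mem_set Ax), SigSub (mem_set Ay)).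
Qed.

Lemma sub_entourage_subset (F G : set (A * A)) :
  G `<=` F -> sub_entourages F -> sub_entourages G.
Proof.
move=> GF [L EL LF]; exists (sub_pair @` G).
  by apply: entourage_subset EL => _ [p Gp <-]; move: (GF _ Gp); rewrite -LF.
apply/seteqP; split=> [p [q Gq /sub_pair_inj <-] //|p Gp].
by exists p.
Qed.

Lemma sub_entourageU (F G : set (A * A)) :
  sub_entourages F -> sub_entourages G -> sub_entourages (F `|` G).
Proof.
by move=> [L EL <-] [M EM <-]; exists (L `|` M); first exact: entourageU.
Qed.

Lemma sub_entourage_diag : sub_entourages diagonal.
Proof.
exists diagonal; first exact: entourage_diag.
by apply/seteqP; split=> -[x y] => [/val_inj|/(congr1 val)].
Qed.

Lemma sub_entourage_inv (F : set (A * A)) :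
  sub_entourages F -> sub_entourages (F^-1)%relation.
Proof. by move=> [L EL <-]; exists (L^-1)%relation; first exact: entourage_inv. Qed.

Lemma sub_entourage_comp (F G : set (A * A)) :
  sub_entourages F -> sub_entourages G -> sub_entourages (F \; G)%relation.
Proof.
move=> [L EL <-] [M EM <-].
apply: (@sub_entourage_subset (sub_pair @^-1` (L \; M)%relation)).
  by move=> [x z] [y /= Lxy Myz]; exists (val y).
by exists (L \; M)%relation; first exact: entourage_comp.
Qed.

Definition sub_coarse : coarse_structure A :=
  CoarseStructure sub_entourage_subset sub_entourageU sub_entourage_diag
    sub_entourage_inv sub_entourage_comp.

End Subspace.

Definition entourage_disjoint (X : Type) (L : set (X * X)) (U : set (set X)) :=
  forall A B : set X, U A -> U B -> A <> B -> (A `*` B) `&` L = set0.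

Definition uniformly_bounded (X : Type) (E : coarse_structure X)
    (U : set (set X)) :=
  entourages E (\bigcup_(A in U) (A `*` A)).

(* Sequences are indexed from 0: [L i] and [U i] stand for $L_{i+1}$ and
   $\mathcal{U}^{i+1}$. *)
Definition coarse_property_C (X : Type) (E : coarse_structure X) :=
  forall L : nat -> set (X * X),
    (forall i, entourages E (L i)) ->
    (forall i, L i `<=` L i.+1) ->
    exists (n : nat) (U : 'I_n -> set (set X)),
      [/\ \bigcup_(A in \bigcup_(i : 'I_n) U i) A = [set: X],
          forall i : 'I_n, uniformly_bounded E (U i)
        & forall i : 'I_n, entourage_disjoint (L i) (U i)].

(* Main.v *)
Require Import Defs.
From mathcomp Require Import all_boot.
From mathcomp Require Import boolp classical_sets.

Local Open Scope classical_set_scope.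

(** If [n] families work for [X1] and the sequence [L], apply property C of [X2]
    to the shifted sequence [i |-> L (n + i)]; the concatenation of the two
    finite sequences of families then works for [X] and [L]. *)

Section Pushforward.
Context {X : Type} (E : coarse_structure X) (A : set X).

Definition sub_family (U : set (set A)) : set (set X) :=
  [set [set val x | x in B] | B in U].

(** The union of squares for [U] is the preimage of some entourage [L] of [E], and this same [L]
    contains the squares of the pushed-forward sets. *)
Lemma uniformly_bounded_sub (U : set (set A)) :
  uniformly_bounded (sub_coarse E A) U -> uniformly_bounded E (sub_family U).
Proof.
move=> [L EL LU]; apply: entourage_subset EL.
move=> [_ _] [_ [B UB <-]] [/= [x Bx <-] [y By <-]].
suff: (sub_pair (A := A) @^-1` L) (x, y) by [].
by rewrite LU; exists B.
Qed.

(** Pushed-forward sets consist of points of [A], so a pair of [L] between two of them comes from a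
    pair of its preimage; distinct images come from distinct sets. *)
Lemma entourage_disjoint_sub (L : set (X * X)) (U : set (set A)) :
  entourage_disjoint (sub_pair (A := A) @^-1` L) U ->
  entourage_disjoint L (sub_family U).
Proof.
move=> dU _ _ [B UB <-] [C UC <-] BC; rewrite -subset0.
move=> [_ _] [[/= [x Bx <-] [y Cy <-]] Lxy].
have BneqC : B <> C by move=> eqBC; apply: BC; rewrite eqBC.
by rewrite -[False]/(set0 (x, y)) -(dU B C UB UC BneqC).
Qed.

(** Moves property C of the subspace into [X], so that families obtained from different subspaces
    can be put in one sequence. *)
Lemma coarse_property_C_sub : coarse_property_C (sub_coarse E A) ->
  forall L : nat -> set (X * X),
    (forall i, entourages E (L i)) ->
    (forall i, L i `<=` L i.+1) ->
    exists (n : nat) (U : 'I_n -> set (set X)),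
      [/\ A `<=` \bigcup_(B in \bigcup_(i : 'I_n) U i) B,
          forall i : 'I_n, uniformly_bounded E (U i)
        & forall i : 'I_n, entourage_disjoint (L i) (U i)].
Proof.
move=> CA L EL Lincr.
have [i|i p|n [U [covU bU dU]]] := CA (fun i => sub_pair (A := A) @^-1` L i).
- by exists (L i).
- exact: Lincr.
exists n, (fun i => sub_family (U i)); split=> [x Ax|i|i].
- have : [set: A] (SigSub (mem_set Ax)) by [].
  rewrite -covU => -[B [i _ UiB] Bx].
  exists [set val y | y in B]; first by exists i => //; exists B.
  by exists (SigSub (mem_set Ax)).
- exact: uniformly_bounded_sub.
- exact: entourage_disjoint_sub.
Qed.

End Pushforward.

Theorem theorem3p13 (X : Type) (E : coarse_structure X) (X1 X2 : set X)
    (hX : [set: X] = X1 `|` X2)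
    (h1 : coarse_property_C (sub_coarse E X1))
    (h2 : coarse_property_C (sub_coarse E X2)) :
  coarse_property_C E.
Proof.
move=> L EL Lincr.
have [n [U [covU bU dU]]] := coarse_property_C_sub E X1 h1 L EL Lincr.
have [i|i|m [V [covV bV dV]]] :=
  coarse_property_C_sub E X2 h2 (fun i => L (n + i)).
- exact: EL.
- by rewrite addnS; exact: Lincr.
exists (n + m), (fun i => match split i with inl j => U j | inr k => V k end).
split=> [|i|i].
- rewrite -subTset hX => x [/covU|/covV] [B [i _ UiB] Bx]; exists B => //.
  + by exists (lshift m i) => //; rewrite (unsplitK (inl i)).
  + by exists (rshift n i) => //; rewrite (unsplitK (inr i)).
- by case: split => j; [exact: bU|exact: bV].
(* As natural numbers, [lshift m j] is [j] and [rshift n j] is [n + j], so the shift of the second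
   sequence gives exactly the index required of [L]. *)
- by case: split_ordP => j ->; [exact: dU|exact: dV].
Qed.
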